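(* Let $k\ge 1$ and $n\ge 1$ be integers, let $(l_1,\ldots,l_k)$ be a $k$-tuple of positive integers and put $L=l_1+\cdots+l_k$. Let $F_n^{(l_1,\ldots,l_k)}$ be the set of all $n$-configurations of the $(l_1,\ldots,l_k)$-tennis ball problem (defined below). Then $F_n^{(l_1,\ldots,l_k)}$ is the collection of flag bases of a flag matroid on the set $[nL]=\{1,\ldots,nL\}$. Moreover, for each $i$ with $1\le i\le k$, the $i$-th constituent of this flag matroid is the $n$-th $(l_1+\cdots+l_i,\; l_{i+1}+\cdots+l_k)$-tbp matroid, i.e. the nested matroid $M[(N^{l_1+\cdots+l_i}E^{l_{i+1}+\cdots+l_k})^n]$.
   Context: Nested matroids: let $P$ be a lattice path from $(0,0)$ to $(m,r)$ with steps $E=(1,0)$ and $N=(0,1)$, written as a word in $E,N$ (so $(N^aE^b)^n$ denotes $a$ steps $N$, then $b$ steps $E$, repeated $n$ times). For each lattice path $Q$ from $(0,0)$ to $(m,r)$ with steps $E,N$ that never goes above $P$, let $Q_N=\{i: \text{step } i \text{ of } Q \text{ is } N\}$. The sets $Q_N$ are the bases of a matroid $M[P]$ on $[m+r]$. For nonnegative integers $a,b$, the matroid $M[(N^aE^b)^n]$ is called the $n$-th $(a,b)$-tbp matroid. Quotients: for matroids $M,N$ on the same ground set, $M$ is a quotient of $N$ if every flat of $M$ is a flat of $N$. An ordered $k$-partition of a set $S$ is a $k$-tuple $(A_1,\ldots,A_k)$ of nonempty, pairwise disjoint sets whose union is $S$. A flag matroid is a pair $(S,\mathcal{F})$ where $\mathcal{F}$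 is a collection of ordered $k$-partitions of $S$ such that: (F1) for $1\le i\le k$, $\mathcal{B}_i=\{B_1\cup\cdots\cup B_i : (B_1,\ldots,B_k)\in\mathcal{F}\}$ is the set of bases of a matroid $M_i$ on $S$; (F2) for $1\le i\le k-1$, $M_i$ is a quotient of $M_{i+1}$; (F3) if $(A_1,\ldots,A_k)$ is an ordered $k$-partition of $S$ such that $A_1\cup\cdots\cup A_i$ is a basis of $M_i$ for every $1\le i\le k$, then $(A_1,\ldots,A_k)\in\mathcal{F}$. The elements of $\mathcal{F}$ are the flag bases and $M_1,\ldots,M_k$ are the constituents. The $(l_1,\ldots,l_k)$-tennis ball problem: there are balls numbered $1,2,\ldots$ and bins $\Gamma_1,\ldots,\Gamma_k$, initially empty. In turn $t$ ($t=1,2,\ldots$), balls $(t-1)L+1,\ldots,tL$ are put into $\Gamma_1$; then, successively for $j=2,\ldots,k$, exactly $l_j+l_{j+1}+\cdots+l_k$ of the balls currently in $\Gamma_{j-1}$ (chosen arbitrarily) are moved to $\Gamma_j$. After $n$ turns bin $\Gamma_j$ contains exactly $nl_j$ balls, and the balls in the bins form an ordered $k$-partition (contents of $\Gamma_1,\ldots,\Gamma_k$) of $[nL]$. An $n$-configuration is an ordered $k$-partition of $[nL]$ that arises in this way after $n$ turns for some choice of moves. *)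

(* Defs.v *)
From HB Require Import structures.
From mathcomp Require Import all_boot.
From mathcomp Require Import zify.

Set Implicit Arguments.
Unset Strict Implicit.
Unset Printing Implicit Defensive.

(** Everything is 0-indexed: the element [x] of ['I_N] stands for the element
    [x.+1] of [N] = {1, ..., N}, and the index [i] of ['I_k] for the index
    [i.+1] of {1, ..., k}. *)

(** * Matroids on a finite ground set [T] *)

Section Matroids.
Variable T : finType.
Implicit Types (A : {set T}) (BB : {set {set T}}).

Definition basis_exchange BB : bool :=
  [forall B1 in BB, forall B2 in BB, forall x in B1 :\: B2,
     exists y in B2 :\: B1, y |: (B1 :\ x) \in BB].

Definition matroid_bases BB : bool := (BB != set0) && basis_exchange BB.

Record matroid := Matroid { bases : {set {set T}}; _ : matroid_bases bases }.

HB.instance Definition _ := [isSub for bases].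

Definition rank (M : matroid) A : nat := \max_(B in bases M) #|A :&: B|.

Definition flat (M : matroid) A : bool :=
  [forall x, (x \notin A) ==> (rank M A < rank M (x |: A))].

Definition quotient_of (M1 M2 : matroid) : Prop :=
  forall A, flat M1 A -> flat M2 A.

End Matroids.

(** * Flag matroids *)

Section FlagMatroids.
Variables (k : nat) (T : finType).
Implicit Types A : {ffun 'I_k -> {set T}}.

Definition ordered_partition A : bool :=
  [&& [forall i, A i != set0],
      [forall i, forall j, (i != j) ==> [disjoint A i & A j]]
    & \bigcup_i A i == [set: T]].

Definition prefix_union (i : 'I_k) A : {set T} := \bigcup_(j < k | j <= i) A j.

Record flag_matroid := FlagMatroid {
  flag_bases : {set {ffun 'I_k -> {set T}}};
  constituent : 'I_k -> matroid T;
  flag_basis_partition : forall A, A \in flag_bases -> ordered_partition A;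
  constituent_bases : forall i,
    bases (constituent i) = [set prefix_union i A | A in flag_bases];
  constituent_quotient : forall i j : 'I_k, j = i.+1 :> nat ->
    quotient_of (constituent i) (constituent j);
  flag_basis_saturated : forall A, ordered_partition A ->
    (forall i, prefix_union i A \in bases (constituent i)) ->
    A \in flag_bases
}.

End FlagMatroids.

(** * Nested matroids *)

(** A lattice path starting at (0,0) is the word of its steps; [true] is the
    step N = (0,1) and [false] is the step E = (1,0). *)
Notation stepN := true (only parsing).
Notation stepE := false (only parsing).

Definition path_point (Q : seq bool) (s : nat) : nat * nat :=
  (count_mem stepE (take s Q), count_mem stepN (take s Q)).

Section Nested.
Variable N : nat.
Implicit Types (P Q : N.-tuple bool) (A : {set 'I_N}).

Definition same_end Q P : bool := path_point Q N == path_point P N.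

(** Each lattice point of [Q] has a point of [P] on its vertical line which is
    at least as high. *)
Definition never_above Q P : bool :=
  [forall s : 'I_N.+1, exists t : 'I_N.+1,
     ((path_point P t).1 == (path_point Q s).1) &&
     ((path_point Q s).2 <= (path_point P t).2)].

Definition north_steps Q : {set 'I_N} := [set i | tnth Q i].

Definition nested_bases P : {set {set 'I_N}} :=
  [set north_steps Q | Q : N.-tuple bool & same_end Q P && never_above Q P].

Lemma path_point_sum Q s : s <= N ->
  (path_point Q s).1 + (path_point Q s).2 = s.
Proof.
move=> sN; have /size_takel sQ : s <= size Q by rewrite size_tuple.
rewrite addnC -[RHS]sQ -(count_predC (pred1 stepN)) /=; congr addn.
by apply: eq_count => -[].
Qed.

Lemma path_point_mono Q s t : s <= t ->
  (path_point Q s).1 <= (path_point Q t).1 /\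
  (path_point Q s).2 <= (path_point Q t).2.
Proof.
by move=> st; rewrite /path_point /= -(subnKC st) takeD !count_cat !leq_addr.
Qed.

Lemma path_point_step Q s : (path_point Q s.+1).1 <= (path_point Q s).1.+1.
Proof.
rewrite /path_point /= -(addn1 s) takeD count_cat -[(count _ _).+1]addn1 leq_add2l.
by rewrite (leq_trans (count_size _ _)) // size_take_min geq_minl.
Qed.

Lemma never_aboveP Q P : same_end Q P ->
  reflect (forall s, s <= N -> (path_point Q s).2 <= (path_point P s).2)
          (never_above Q P).
Proof.
move=> /eqP eQP; apply: (iffP forallP) => [H s sN|H s].
  have /existsP[t /andP[/eqP e le]] := H (Ordinal (sN : s < N.+1)).
  have tN : t <= N by rewrite -ltnS.
  have := path_point_sum Q sN; have := path_point_sum P sN.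
  have := path_point_sum P tN; move: e le => /= e le h1 h2 h3.
  have st : s <= t by lia.
  have [] := path_point_mono P st; rewrite /path_point /=; lia.
have sN : s <= N by rewrite -ltnS.
pose p t := (t <= N) && ((path_point Q s).1 <= (path_point P t).1).
have exp : exists t, p t.
  exists N; rewrite /p leqnn -eQP /=.
  by have [] := path_point_mono Q sN.
case: (ex_minnP exp) => t /andP[tN le] tmin.
have e : (path_point P t).1 = (path_point Q s).1.
  case: t tN le tmin => [|t] tN le tmin.
    by move: le; rewrite /path_point take0 /=; lia.
  have := path_point_step P t; have : ~~ p t.
    by apply/negP => /tmin; rewrite ltnn.
  rewrite /p; lia.
have [st|ts] := leqP s t; last first.
  apply/existsP; exists s; rewrite H // andbT.
  have := path_point_sum P sN; have := path_point_sum Q sN; have := H s sN.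
  have [] := path_point_mono P (ltnW ts); lia.
apply/existsP; exists (Ordinal (tN : t < N.+1)); apply/andP; split; first exact/eqP.
by have [_ /(leq_trans (H s sN))] := path_point_mono P st.
Qed.

Definition below A (s : nat) : {set 'I_N} := [set i in A | i < s].

Lemma north_count Q s : s <= N -> (path_point Q s).2 = #|below (north_steps Q) s|.
Proof.
move=> sN; rewrite /path_point /=.
have -> : take s Q = mkseq (nth stepE Q) s.
  by rewrite -[in LHS](mkseq_nth stepE Q) size_tuple /mkseq -map_take take_iota
             (minn_idPl sN).
rewrite count_map -sumn_count sumnE big_map.
have -> : iota 0 s = index_iota 0 s by rewrite /index_iota subn0.
rewrite big_mkord (big_ord_widen N (fun i => nat_of_bool (nth _ Q i == true)) sN).
rewrite -sum1_card big_mkcond [RHS]big_mkcond; apply: eq_bigr => i _.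
by rewrite !inE (tnth_nth stepE) andbC; case: ifP => //= _; case: nth.
Qed.

Lemma mem_nested_bases P A :
  reflect (#|A| = #|north_steps P| /\
           forall s, s <= N -> #|below A s| <= #|below (north_steps P) s|)
          (A \in nested_bases P).
Proof.
have belowN B : below B N = B by apply/setP => i; rewrite !inE ltn_ord andbT.
have endP Q : same_end Q P = (#|north_steps Q| == #|north_steps P|).
  have := path_point_sum Q (leqnn N); have := path_point_sum P (leqnn N).
  rewrite -[north_steps Q]belowN -[north_steps P]belowN -!north_count //.
  rewrite /same_end; case: (path_point Q N) (path_point P N) => [a b] [c d] /=.
  rewrite xpair_eqE; lia.
apply: (iffP imsetP) => [[Q /[!inE] /andP[eQ /(never_aboveP eQ) nQ] ->]|[eA nA]].
  split=> [|s sN]; first by apply/eqP; rewrite -endP.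
  by rewrite -!north_count ?nQ.
have defA : A = north_steps [tuple i \in A | i < N].
  by apply/setP => i; rewrite inE tnth_mktuple.
exists [tuple i \in A | i < N] => //; rewrite inE.
have eQ : same_end [tuple i \in A | i < N] P by rewrite endP -defA eA.
rewrite eQ; apply/(never_aboveP eQ) => s sN.
by rewrite !north_count // -defA nA.
Qed.

Lemma nested_bases_matroid P : matroid_bases (nested_bases P).
Proof.
apply/andP; split.
  by apply/set0Pn; exists (north_steps P); apply/mem_nested_bases.
apply/forall_inP => B1 /mem_nested_bases[e1 n1].
apply/forall_inP => B2 /mem_nested_bases[e2 n2].
apply/forall_inP => x /setDP[x1 x2].
have e21 : #|B2 :\: B1| = #|B1 :\: B2|.
  by have := cardsID B2 B1; have := cardsID B1 B2; rewrite setIC; lia.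
have [y0 y0D] : exists y, y \in B2 :\: B1.
  by apply/card_gt0P; rewrite e21; apply/card_gt0P; exists x; rewrite inE x2.
have [y yD ymax] := @arg_maxnP _ y0 (mem (B2 :\: B1)) val y0D.
have /setDP[y2 y1] := yD.
apply/exists_inP; exists y => //; apply/mem_nested_bases.
have yx : y != x by apply: contraNneq x2 => <-.
have belowE s : #|below (y |: (B1 :\ x)) s| + (x < s) = #|below B1 s| + (y < s).
  have cardS B : #|below B s| = \sum_(i in B) (i < s).
    by rewrite -sum1_card big_mkcond [RHS]big_mkcond; apply: eq_bigr => i _;
       rewrite !inE; case: (i \in B); case: (i < s).
  rewrite !cardS big_setU1 ?inE ?(negbTE y1) ?andbF //=.
  by rewrite [in RHS](big_setD1 x) //=; lia.
have cardE : #|y |: (B1 :\ x)| = #|B1|.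
  by rewrite cardsU1 inE (negbTE y1) andbF (cardsD1 x B1) x1.
split=> [|s sN]; first by rewrite cardE.
have := belowE s; have := n1 s sN; have [xs|sx] := ltnP x s; first by lia.
have [ys|sy] := ltnP y s; last by lia.
suff : #|below B1 s| < #|below B2 s| by have := n2 s sN; lia.
have cardC (B : {set 'I_N}) : #|B| = #|below B s| + #|[set i in B | s <= i]|.
  rewrite -(cardsID [set i : 'I_N | i < s] B); congr (_ + _).
    by apply: eq_card => i; rewrite !inE.
  by apply: eq_card => i; rewrite !inE -leqNgt andbC.
suff /proper_card : [set i in B2 | s <= i] \proper [set i in B1 | s <= i].
  by have := cardC B1; have := cardC B2; lia.
apply/properP; split; last by exists x; rewrite !inE ?x1 ?(negbTE x2).
apply/subsetP => i; rewrite !inE => /andP[i2 si]; rewrite si andbT.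
apply: contraTT si => i1; rewrite -ltnNge (leq_ltn_trans _ ys) //.
by apply: ymax; rewrite /= inE i1.
Qed.

Definition nested_matroid P : matroid 'I_N := Matroid (nested_bases_matroid P).

End Nested.

(** The word (N^a E^b)^n. *)
Definition tbp_word (n a b : nat) : seq bool :=
  flatten (nseq n (nseq a stepN ++ nseq b stepE)).

Lemma size_tbp_word n a b : size (tbp_word n a b) == n * (a + b).
Proof.
by rewrite size_flatten /shape map_nseq sumn_nseq size_cat !size_nseq mulnC.
Qed.

Definition tbp_path n a b : (n * (a + b)).-tuple bool :=
  Tuple (size_tbp_word n a b).

(** The [n]-th (a,b)-tbp matroid; the proof of [n * (a + b) = N] only serves to
    present its ground set as ['I_N]. *)
Definition tbp_matroid n a b N (eN : n * (a + b) = N) : matroid 'I_N :=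
  nested_matroid (tcast eN (tbp_path n a b)).
Arguments tbp_matroid n a b {N} eN.

(** * The tennis ball problem *)

Section TennisBall.
Variables (k : nat) (l : 'I_k -> nat).

Definition balls_per_turn : nat := \sum_j l j.

Section Balls.
(** Balls not below [N] are ignored. *)
Variable N : nat.

(** The contents of each bin. *)
Definition bins := {ffun 'I_k -> {set 'I_N}}.
Implicit Type G : bins.

Definition empty_bins : bins := [ffun _ => set0].

(** Turn [t.+1] puts the balls numbered [t * L + 1], ..., [t.+1 * L] into the
    first bin. *)
Definition new_balls (t : nat) : {set 'I_N} :=
  [set x : 'I_N | t * balls_per_turn <= x < t.+1 * balls_per_turn].

Definition put_new (t : nat) G : bins :=
  [ffun j : 'I_k => if j == 0 :> nat then G j :|: new_balls t else G j].

Definition move_balls (j : 'I_k) (X : {set 'I_N}) G : bins :=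
  [ffun i => if i == ord_pred j then G i :\: X
             else if i == j then G i :|: X else G i].

(** All outcomes of a move from the bin preceding [j] to bin [j], for
    [0 < j]. *)
Definition moves_into (j : 'I_k) G : {set bins} :=
  [set move_balls j X G | X : {set 'I_N}
     & (X \subset G (ord_pred j)) && (#|X| == \sum_(h < k | j <= h) l h)].

(** The moves are made successively, in increasing order of [j]. *)
Definition turn (t : nat) G : {set bins} :=
  foldl (fun (GG : {set bins}) j => \bigcup_(G' in GG) moves_into j G')
        [set put_new t G] [seq j : 'I_k <- enum 'I_k | 0 < j].

Fixpoint after_turns (t : nat) : {set bins} :=
  if t is t'.+1 then \bigcup_(G in after_turns t') turn t' G
  else [set empty_bins].

End Balls.

Definition configurations (n : nat) : {set bins (n * balls_per_turn)} :=
  after_turns (n * balls_per_turn) n.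

Lemma split_balls (n : nat) (i : 'I_k) :
  n * (\sum_(j < k | j <= i) l j + \sum_(j < k | i < j) l j) =
  n * balls_per_turn.
Proof.
rewrite /balls_per_turn [in RHS](bigID (fun j : 'I_k => j <= i)) /=.
by congr (_ * (_ + _)); apply: eq_bigl => j; rewrite ltnNge.
Qed.

End TennisBall.

(* Main.v *)
Require Import Defs.
From mathcomp Require Import all_boot.
From mathcomp Require Import zify.

(** Put [a_i = l_1 + ... + l_i].  The bases of the [i]-th tbp matroid are the sets
    of [n a_i] balls containing, for every [s <= n], at most [s a_i] of the first
    [s L] balls.  An ordered partition is an [n]-configuration iff all its prefix
    unions are bases: conversely to the obvious direction, the state before the
    last turn is recovered by extending the restricted prefix unions to a chain of
    bases for [n - 1] turns.  Extension inside a basis of the next matroid is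
    possible because above the last tight constraint a maximal independent set
    contains everything available.  The same fact gives the rank formula
    [min_s (s a_i + #|A above s L|)], from which the quotient property follows:
    passing from [a_i] to [a_(i+1)] increases the value at [s] by a multiple of
    [s], so it can only move the minimizers to the left. *)

Set Implicit Arguments.
Unset Strict Implicit.
Unset Printing Implicit Defensive.

(** * Independence constraints at the turn boundaries *)

Section Independence.
Variables N L : nat.
Implicit Types (A B C D I : {set 'I_N}) (x : 'I_N) (a s t : nat).

Definition above A s : {set 'I_N} := [set x in A | s <= x].

Lemma below_above A s : #|A| = #|below A s| + #|above A s|.
Proof.
rewrite -(cardsID [set x : 'I_N | x < s] A); congr (_ + _).
  by apply: eq_card => x; rewrite !inE.
by apply: eq_card => x; rewrite !inE -leqNgt andbC.
Qed.

Lemma belowS A B s : A \subset B -> below A s \subset below B s.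
Proof.
move=> /subsetP sAB; apply/subsetP => x; rewrite !inE => /andP[/sAB ->].
by case: (x < s).
Qed.

Lemma aboveS A B s : A \subset B -> above A s \subset above B s.
Proof.
move=> /subsetP sAB; apply/subsetP => x; rewrite !inE => /andP[/sAB ->].
by case: (s <= x).
Qed.

Lemma card_belowU1 x A s : x \notin A ->
  #|below (x |: A) s| = (x < s) + #|below A s|.
Proof.
move=> xA; have [xs|sx] := ltnP x s.
  rewrite -[RHS]/(true + _) (_ : true = (x \notin below A s)); last first.
    by rewrite inE (negbTE xA).
  rewrite -cardsU1; apply: eq_card => y; rewrite !inE.
  by case: eqP => // ->; rewrite xs.
apply: eq_card => y; rewrite !inE; case: eqP => //= ->.
by rewrite (negbTE xA) ltnNge sx.
Qed.

Lemma card_aboveU1 x A s : x \notin A ->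
  #|above (x |: A) s| = (s <= x) + #|above A s|.
Proof.
move=> xA; have := below_above A s; have := below_above (x |: A) s.
rewrite cardsU1 xA card_belowU1 //; lia.
Qed.

Lemma card_initial s : s <= N -> #|[set x : 'I_N | x < s]| = s.
Proof.
move=> sN; rewrite -sum1_card (eq_bigl (fun x : 'I_N => x < s)); last first.
  by move=> x; rewrite inE.
by rewrite -(big_ord_widen N (fun=> 1) sN) sum1_card card_ord.
Qed.

(** Only turn boundaries are constrained: for sets of [n * a] balls this already describes the bases
    of the tbp matroid, by [tbp_bases]. Balls from [t * L] on are unconstrained. *)
Definition indep t a I : bool :=
  [forall s : 'I_t.+1, #|below I (s * L)| <= s * a].

Lemma indepP t a I :
  reflect (forall s, s <= t -> #|below I (s * L)| <= s * a) (indep t a I).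
Proof.
apply: (iffP forallP) => [H s st|H s]; last by apply: H; rewrite -ltnS.
exact: (H (Ordinal (st : s < t.+1))).
Qed.

Lemma indep_leq t a a' I : a <= a' -> indep t a I -> indep t a' I.
Proof.
move=> aa' /indepP iI; apply/indepP => s st.
by apply: leq_trans (iI s st) _; rewrite leq_mul2l aa' orbT.
Qed.

Lemma indep0 t a : indep t a set0.
Proof.
apply/indepP => s _; rewrite (_ : below _ _ = set0) ?cards0 //.
by apply/setP => x; rewrite !inE.
Qed.

(* [I] is maximal, and [s] is its last tight constraint. *)
Lemma indep_saturate t a C A : C \subset A -> indep t a C ->
  exists I s, [/\ C \subset I, I \subset A, indep t a I, s <= t
    & #|below I (s * L)| = s * a /\ above A (s * L) \subset I].
Proof.
move=> sCA iC; pose p I := [&& C \subset I, I \subset A & indep t a I].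
have pC : p C by rewrite /p subxx sCA.
have [I /and3P[sCI sIA /[dup] iI /indepP iI'] Imax] := @arg_maxnP _ C p (fun I => #|I|) pC.
pose tight s := (s <= t) && (#|below I (s * L)| == s * a).
have ext : exists s, tight s.
  by exists 0; rewrite /tight -leqn0; apply: (iI' 0).
have tight_le s : tight s -> s <= t by case/andP.
case: (ex_maxnP ext tight_le) => s /andP[st /eqP es] smax.
exists I, s; split=> //; split=> //; apply/subsetP => x; rewrite inE => /andP[xA sx].
apply: contraT => xI; have : p (x |: I).
  apply/and3P; split; first exact: subset_trans sCI (subsetUr _ _).
    by rewrite subUset sub1set xA.
  apply/indepP => u ut; rewrite card_belowU1 //.
  have [xu|_] := ltnP x; last exact: iI'.
  have := iI' u ut; rewrite leq_eqVlt => /orP[tu|]; last by [].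
  (* Adding [x] could break only a tight constraint [u] with [x < u * L], but [u <= s] by maximality
     and [s * L <= x]. *)
  have /smax us : tight u by rewrite /tight ut.
  have : u * L <= s * L by rewrite leq_mul2r us orbT.
  lia.
by move=> /Imax; rewrite cardsU1 xI; lia.
Qed.

(** Saturate [C] inside [D]. From the last tight [s * L] on, [I] contains all of [D], hence at least
    [(t - s) * a'] balls, since [D] has at most [s * a'] before. With the [s * a] balls of [I]
    before, this reaches [t * a]. *)
Lemma indep_extend t a a' C D : a <= a' -> C \subset D ->
    indep t a C -> indep t a' D -> #|D| = t * a' ->
    (forall x, x \in D -> x < t * L) ->
  exists I, [/\ C \subset I, I \subset D, indep t a I & #|I| = t * a].
Proof.
move=> aa' sCD iC /indepP iD cD ltD.
have [I [s [sCI sID iI st [es sDI]]]] := indep_saturate sCD iC.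
exists I; split=> //; apply/eqP; rewrite eqn_leq; apply/andP; split.
  move/indepP: iI => /(_ t (leqnn t)); congr (_ <= _).
  apply: eq_card => x; rewrite inE; case: (boolP (x \in I)) => //= xI.
  by rewrite ltD // (subsetP sID).
have : #|above D (s * L)| <= #|above I (s * L)|.
  apply/subset_leq_card/subsetP => x xD; rewrite inE (subsetP sDI) //.
  by move: xD; rewrite inE => /andP[].
have := below_above I (s * L); have := below_above D (s * L); have := iD s st.
have : (t - s) * a <= (t - s) * a' by rewrite leq_mul2l aa' orbT.
have : s * a <= t * a by rewrite leq_mul2r st orbT.
have : s * a' <= t * a' by rewrite leq_mul2r st orbT.
rewrite !mulnBl; lia.
Qed.

End Independence.

(** * Rank formula and quotients *)

Section Quotient.
Variables n L : nat.
Local Notation N := (n * L).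
Implicit Types (M : matroid 'I_N) (A B : {set 'I_N}).

Definition bases_spec M a : Prop :=
  forall B, (B \in bases M) = (#|B| == n * a) && indep L n a B.

(* The rank of [A] is the minimum over [s] of [s * a + #|above A (s * L)|]. *)
Lemma rank_leq M a A s : bases_spec M a -> s <= n ->
  rank M A <= s * a + #|above A (s * L)|.
Proof.
move=> HM sn; apply/bigmax_leqP => B; rewrite HM => /andP[_ /indepP iB].
rewrite (below_above (A :&: B) (s * L)) leq_add //.
  apply: leq_trans (iB s sn).
  exact/subset_leq_card/belowS/subsetIr.
exact/subset_leq_card/aboveS/subsetIl.
Qed.

Lemma rank_attained M a A : a <= L -> bases_spec M a ->
  exists2 s, s <= n & rank M A = s * a + #|above A (s * L)|.
Proof.
move=> aL HM.
have [I [s [_ sIA iI sn [es sAI]]]] := indep_saturate (sub0set A) (indep0 N L n a).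
exists s => //; apply/eqP; rewrite eqn_leq rank_leq //=.
(* The whole ground set is a basis for the parameter [L], so [I] extends to a basis inside it. *)
have [B [sIB _ iB cB]] : exists B, [/\ I \subset B, B \subset setT, indep L n a B & #|B| = n * a].
  apply: (indep_extend aL) => //; last by rewrite cardsT card_ord.
  apply/indepP => u un; rewrite (leq_trans (subset_leq_card (_ : _ \subset [set x : 'I_N | x < u * L]))) //.
    by apply/subsetP => x; rewrite !inE.
  by rewrite card_initial // leq_mul2r un orbT.
have BM : B \in bases M by rewrite HM cB eqxx.
apply: leq_trans (leq_bigmax_cond _ BM).
apply: (@leq_trans #|I|); last by rewrite subset_leq_card // subsetI sIA.
rewrite (below_above I (s * L)) es leq_add2l subset_leq_card //.
apply/subsetP => x xA; rewrite inE (subsetP sAI) //.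
by move: xA; rewrite inE => /andP[].
Qed.

Lemma nested_quotient M1 M2 a1 a2 : a1 <= a2 -> a2 <= L ->
  bases_spec M1 a1 -> bases_spec M2 a2 -> quotient_of M1 M2.
Proof.
move=> a12 a2L H1 H2 A /forallP fA; apply/forallP => x.
apply/implyP => xA; have /implyP/(_ xA) lt1 := fA x.
have [s sn e1] := rank_attained A (leq_trans a12 a2L) H1.
have [s' s'n e2] := rank_attained (x |: A) a2L H2.
have := rank_leq (x |: A) H1 sn; have := rank_leq (x |: A) H1 s'n.
have := rank_leq A H2 s'n; have := rank_leq A H2 sn.
move: e2; rewrite !card_aboveU1 // => e2.
(* If [x] is counted at [s'], the bound for [A] at [s'] is one less than the rank of [x |: A] in
   [M2]. *)
have [|xs'] := leqP (s' * L) x; first by lia.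
(* Adding [x] raises the rank in [M1], so [x] is counted at the minimizer [s] of [A]; it is not
   counted at [s'], whence [s < s']. *)
move=> r1 r2 r3 r4; have sx : s * L <= x by lia.
have ss' : s < s'.
  rewrite ltnNge; apply/negP => s's.
  have : s' * L <= s * L by rewrite leq_mul2r s's orbT.
  lia.
(* For [A] the value in [M1] at [s] is smaller than at [s']; replacing [a1] by [a2] adds no more at
   [s] than at [s'], so the order persists. *)
have : (s' - s) * a1 <= (s' - s) * a2 by rewrite leq_mul2l a12 orbT.
have : s * a1 <= s' * a1 by rewrite leq_mul2r (ltnW ss') orbT.
have : s * a2 <= s' * a2 by rewrite leq_mul2r (ltnW ss') orbT.
rewrite !mulnBl; lia.
Qed.

End Quotient.

(** * Bases of the tbp matroids *)

Lemma count_tbp_word n a b s : s <= n * (a + b) ->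
  count_mem true (take s (tbp_word n a b)) =
  s %/ (a + b) * a + minn (s %% (a + b)) a.
Proof.
elim: n s => [|n IH] s sn.
  by move: sn; rewrite leqn0 => /eqP ->; rewrite div0n mod0n min0n.
have -> : tbp_word n.+1 a b = (nseq a true ++ nseq b false) ++ tbp_word n a b by [].
rewrite take_cat size_cat !size_nseq; have [slt|sge] := ltnP s (a + b).
  rewrite divn_small // modn_small // mul0n add0n take_cat size_nseq.
  have [sa|sa] := ltnP s a.
    by rewrite take_nseq ?(ltnW sa) // count_nseq mul1n.
  rewrite count_cat take_nseq ?leq_subLR ?(ltnW slt) // !count_nseq.
  by rewrite mul1n mul0n addn0.
rewrite !count_cat !count_nseq IH; last by rewrite leq_subLR -mulSn.
rewrite mul1n mul0n addn0; have [ab0|ab0] := posnP (a + b).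
  have /eqP-> : a == 0 by rewrite -leqn0 -ab0 leq_addr.
  by rewrite !muln0 !minn0.
by rewrite -[in RHS](subnK sge) divnDr ?dvdnn // divnn ab0 modnDr mulnDl mul1n addnAC addnC.
Qed.

(** After [s = q * (a + b) + r] steps the path has height [min (q * a + r, q.+1 * a)]. The first
    bound follows from the constraint at [q], as each further step adds at most one ball, the second
    from the constraint at [q.+1]. *)
Lemma tbp_bases n a b N (eN : n * (a + b) = N) (A : {set 'I_N}) :
  (A \in bases (tbp_matroid n a b eN)) = (#|A| == n * a) && indep (a + b) n a A.
Proof.
subst N; set P := tbp_path n a b.
have cP s : s <= n * (a + b) ->
    #|below (north_steps P) s| = s %/ (a + b) * a + minn (s %% (a + b)) a.
  by move=> sN; rewrite -north_count // -(count_tbp_word sN).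
have cPm s : s <= n -> #|below (north_steps P) (s * (a + b))| = s * a.
  move=> sn; rewrite cP ?leq_mul2r ?sn ?orbT //.
  have [/eqP|ab0] := posnP (a + b).
    by rewrite addn_eq0 => /andP[/eqP -> _]; rewrite !muln0 minn0.
  by rewrite mulnK // modnMl min0n addn0.
have cPN : #|north_steps P| = n * a.
  by rewrite -cPm //; apply: eq_card => x; rewrite !inE ltn_ord andbT.
apply/mem_nested_bases/andP; rewrite tcast_id -/P cPN.
  move=> [cA bA]; split; first exact/eqP.
  by apply/indepP => s sn; rewrite -cPm // bA // leq_mul2r sn orbT.
move=> [/eqP cA /indepP iA]; split=> // s sN; rewrite cP //.
have [ab0|ab0] := posnP (a + b).
  have -> : below A s = set0 by apply/setP => x; have := ltn_ord x; lia.
  by rewrite cards0.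
move: (divn_eq s (a + b)) (ltn_pmod s ab0).
move: (s %/ (a + b)) (s %% (a + b)) => q r es rL.
have qn : q <= n by rewrite -(leq_pmul2r ab0); lia.
rewrite addn_minr leq_min; apply/andP; split.
  have := iA q qn; have : #|below A s| <= #|below A (q * (a + b))| + r.
    have := below_above (below A s) (q * (a + b)).
    have -> : below (below A s) (q * (a + b)) = below A (q * (a + b)).
      by apply/setP => x; rewrite !inE; lia.
    move=> ->; rewrite leq_add2l.
    have := @card_initial (n * (a + b)) s sN.
    rewrite (below_above [set x : 'I_(n * (a + b)) | x < s] (q * (a + b))).
    have -> : below [set x : 'I_(n * (a + b)) | x < s] (q * (a + b))
            = [set x : 'I_(n * (a + b)) | x < q * (a + b)].
      by apply/setP => x; rewrite !inE; lia.
    rewrite card_initial; last by lia.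
    have : #|above (below A s) (q * (a + b))|
        <= #|above [set x : 'I_(n * (a + b)) | x < s] (q * (a + b))|.
      apply/subset_leq_card/aboveS/subsetP => x.
      by rewrite !inE => /andP[].
    lia.
  lia.
(* Beyond [q = n] there is no further constraint; there the size of [A] gives the bound. *)
rewrite -mulSnr; have [qn'|nq] := ltnP q n.
  apply: leq_trans (iA q.+1 qn'); apply/subset_leq_card/subsetP => x.
  by rewrite !inE mulSn; lia.
apply: (@leq_trans #|A|); first by apply/subset_leq_card/subsetP => x; rewrite inE => /andP[].
by rewrite cA leq_mul2r; lia.
Qed.

(** * Tennis ball states as chains of bases *)

Section TennisBall.
Variables (k : nat) (l : 'I_k -> nat).
Local Notation L := (balls_per_turn l).

Definition lsum i : nat := \sum_(j < k | j <= i) l j.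

Lemma lsumS (i : 'I_k) i' : i'.+1 = i -> lsum i = lsum i' + l i.
Proof.
move=> ei; rewrite /lsum (bigD1 i) //= addnC; congr (_ + _).
by apply: eq_bigl => j; rewrite -val_eqE /=; lia.
Qed.

Lemma leq_lsum i i' : i <= i' -> lsum i <= lsum i'.
Proof.
move=> ii'; rewrite /lsum [X in _ <= X](bigID (fun j : 'I_k => j <= i)) /=.
by rewrite [X in _ <= X + _](eq_bigl (fun j : 'I_k => j <= i)) ?leq_addr // => j; lia.
Qed.

Lemma lsum_tail i : lsum i + \sum_(j < k | i < j) l j = L.
Proof.
rewrite /lsum /balls_per_turn [RHS](bigID (fun j : 'I_k => j <= i)) /=.
by congr (_ + _); apply: eq_bigl => j; rewrite ltnNge.
Qed.

Lemma lsum_last : lsum k.-1 = L.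
Proof.
by rewrite -(lsum_tail k.-1) big_pred0 ?addn0 // => j; have := ltn_ord j; lia.
Qed.

Lemma lsum_leq i : lsum i <= L.
Proof. by rewrite -(lsum_tail i) leq_addr. Qed.

Section Positions.
Variable N : nat.
Implicit Types (f g : 'I_N -> nat) (x : 'I_N).

(* A distribution of the balls is encoded by the bin number [f x] of each ball
   [x], with [k <= f x] for the balls not yet in play. *)
Definition bins_of f : bins k N := [ffun j : 'I_k => [set x | f x == j]].

Definition level f i : {set 'I_N} := [set x | f x <= i].

Lemma eq_bins_of f g : f =1 g -> bins_of f = bins_of g.
Proof. by move=> fg; apply/ffunP => j; rewrite !ffunE; apply/setP => x; rewrite !inE fg. Qed.

Lemma prefix_union_bins_of f (i : 'I_k) : prefix_union i (bins_of f) = level f i.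
Proof.
apply/setP => x; rewrite inE; apply/bigcupP/idP => [[j ji]|fi].
  by rewrite ffunE inE => /eqP ->.
by exists (Ordinal (leq_ltn_trans fi (ltn_ord i))); rewrite // ffunE inE.
Qed.

Lemma moves_into_bins_of f (j : 'I_k) m G : j = m.+1 :> nat ->
  reflect (exists2 X : {set 'I_N},
             X \subset [set x | f x == m] /\ #|X| = \sum_(h < k | j <= h) l h
             & G = bins_of (fun x => if x \in X then m.+1 else f x))
          (G \in moves_into l j (bins_of f)).
Proof.
(* [ord_pred] is cyclic; a positive [j] excludes the wrap-around. *)
move=> ej; have ep : ord_pred j = m :> nat.
  by rewrite /= ej addSn /= modnDr modn_small //; have := ltn_ord j; lia.
have mvE (X : {set 'I_N}) : X \subset [set x | f x == m] ->
    move_balls j X (bins_of f) = bins_of (fun x => if x \in X then m.+1 else f x).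
  move=> /subsetP sX; apply/ffunP => i; rewrite !ffunE.
  rewrite (_ : (i == ord_pred j) = (i == m :> nat)); last by rewrite -ep.
  rewrite (_ : (i == j) = (i == m.+1 :> nat)); last by rewrite -ej.
  apply/setP => x; have := sX x.
  case: eqP => [ei|ni]; last case: eqP => [ei|ni']; rewrite !inE;
    case: (x \in X) => /= [/(_ isT)/eqP e|_]; lia.
have bE : bins_of f (ord_pred j) = [set x | f x == m] by rewrite ffunE ep.
apply: (iffP imsetP) => [[X]|[X [sX cX] ->]].
  rewrite inE bE => /andP[sX /eqP cX] ->; exists X => //; exact: mvE.
by exists X; rewrite ?mvE // inE bE sX cX eqxx.
Qed.

(** Net effect of the moves into bins [1], ..., [m], without intermediate states: level [i] changes
    only by the move into bin [i.+1], so one cardinality per level records all the moves. *)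
Definition moved f m g : Prop :=
  (forall x, f x <= g x <= maxn (f x) m) /\
  (forall i, i < m -> #|level g i| + \sum_(h < k | i < h) l h = #|level f i|).

(** Induction on the last move, which takes balls from bin [m] to bin [m.+1] and so changes no level
    but [m]. *)
Lemma foldl_moves f m (s : seq 'I_k) : map val s = iota 1 m -> forall G,
  (G \in foldl (fun (GG : {set bins k N}) j => \bigcup_(G' in GG) moves_into l j G')
               [set bins_of f] s) <->
  (exists2 g, moved f m g & G = bins_of g).
Proof.
elim: m s => [|m IH] s.
  case: s => // _ G; rewrite inE; split => [/eqP ->|[g [fg _] ->]].
    by exists f => //; split=> [x|//]; lia.
  by apply/eqP/eq_bins_of => x; have := fg x; rewrite maxn0; lia.
case/lastP: s => // s j; rewrite -[m.+1]addn1 iotaD add1n cats1 map_rcons.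
move=> /rcons_inj[/IH{}IH ej] G; rewrite foldl_rcons addn1.
split=> [/bigcupP[G1 /IH[g [fg cg] ->]]|[g [fg cg] ->]].
  move=> /(moves_into_bins_of _ _ ej)[X [/subsetP sX cX] ->].
  have {}sX x : x \in X -> g x = m by move=> /sX; rewrite inE => /eqP.
  eexists; last reflexivity; split=> [x|i].
    by have := fg x; have := sX x; case: (x \in X) => [/(_ isT)|_]; lia.
  rewrite ltnS leq_eqVlt => /orP[/eqP ->|im].
    rewrite (_ : level _ m = level g m :\: X); last first.
      apply/setP => x; rewrite !inE.
      by have := sX x; case: (x \in X) => [/(_ isT)|_] /=; lia.
    have -> : level f m = level g m.
      by apply/setP => x; rewrite !inE; have := fg x; lia.
    rewrite -[RHS](cardsID X) addnC; congr (_ + _).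
    rewrite (setIidPr _) ?cX ?ej //.
    by apply/subsetP => x /sX; rewrite inE => ->.
  rewrite -cg //; congr (_ + _); apply: eq_card => x; rewrite !inE.
  by have := sX x; case: (x \in X) => [/(_ isT)|_] /=; lia.
(* The state before the last move: [g] capped at [m], except that balls starting beyond bin [m] stay
   put. *)
pose g1 x := maxn (f x) (minn (g x) m).
apply/bigcupP; exists (bins_of g1).
  apply/IH; exists g1 => //; split=> [x|i im]; first by rewrite /g1; have := fg x; lia.
  rewrite -cg 1?ltnW //; congr (_ + _); apply: eq_card => x; rewrite !inE /g1.
  by have := fg x; lia.
apply/(moves_into_bins_of _ _ ej).
exists (level f m :\: level g m); first split.
- by apply/subsetP => x; rewrite !inE /g1; have := fg x; lia.
- rewrite cardsD (setIidPr _) ?ej; first by have := cg m (leqnn _); lia.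
  by apply/subsetP => x; rewrite !inE; have := fg x; lia.
by apply: eq_bins_of => x; rewrite !inE /g1; have := fg x; case: ifP; lia.
Qed.

(** The new balls are in no bin before the turn, so renumbering them to [0] takes none out of
    another bin. *)
Lemma put_new_bins_of t f :
  (forall x, (f x < k) = (x < t * L)) ->
  put_new l t (bins_of f) =
  bins_of (fun x => if x \in new_balls l N t then 0 else f x).
Proof.
move=> fk; apply/ffunP => j; rewrite !ffunE; apply/setP => x.
have := fk x; have := ltn_ord j.
by case: (j =P 0 :> nat) => j0; rewrite !inE; case: (boolP (_ <= _ < _)) => xt; lia.
Qed.

Lemma turnP t f G : (forall x, (f x < k) = (x < t * L)) ->
  (G \in turn l t (bins_of f)) <->
  (exists2 g, moved (fun x => if x \in new_balls l N t then 0 else f x) k.-1 g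
            & G = bins_of g).
Proof.
move=> fk; rewrite /turn put_new_bins_of //; apply: foldl_moves.
have -> : [seq j : 'I_k <- enum 'I_k | 0 < j] = [seq j <- enum 'I_k | preim val (fun i => 0 < i) j] by [].
rewrite -filter_map val_enum_ord; case: {f fk G} k => //= k'.
by apply/all_filterP/allP => i; rewrite mem_iota => /andP[].
Qed.

(** The invariant after [t] turns: the first [t * L] balls are in play and the levels are bases for
    [t] turns. *)
Definition valid t f : Prop :=
  (forall x, (f x < k) = (x < t * L)) /\
  (forall i, i < k -> #|level f i| = t * lsum i /\ indep L t (lsum i) (level f i)).

Lemma level_last t f : 0 < k -> (forall x, (f x < k) = (x < t * L)) ->
  level f k.-1 = [set x : 'I_N | x < t * L].
Proof. by move=> k0 fk; apply/setP => x; rewrite !inE -fk; lia. Qed.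

(* The bins are filled from the last to the first: a basis of constituent [i]
   inside the basis chosen for constituent [i.+1] is extended from [C i]. *)
Lemma valid_extend t (C : nat -> {set 'I_N}) : 0 < k -> t * L <= N ->
    (forall i, C i \subset C i.+1) ->
    (forall i, i < k -> indep L t (lsum i) (C i)) ->
    (forall i x, i < k -> x \in C i -> x < t * L) ->
  exists2 f, valid t f & forall i, i < k -> C i \subset level f i.
Proof.
move=> k0 tN CS iC ltC.
(* Descending induction: at stage [m] the levels from [m] on are settled, and level [m] sits in bin
   [m] for the time being. *)
suff H d m : m + d = k.-1 -> exists f,
    [/\ forall x, (f x < k) = (x < t * L), forall x, m <= f x &
      forall i, m <= i -> i < k -> [/\ #|level f i| = t * lsum i,
        indep L t (lsum i) (level f i) & C i \subset level f i]].
  have [f [fk _ fi]] := H k.-1 0 (add0n _).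
  exists f => [|i ik]; last by have [] := fi i (leq0n _) ik.
  by split=> // i ik; have [] := fi i (leq0n _) ik.
elim: d m => [|d IH] m md.
  pose f (x : 'I_N) := if x < t * L then k.-1 else k.
  have fk x : (f x < k) = (x < t * L) by rewrite /f; case: ifP; lia.
  exists f; split=> // [x|i mi ik]; first by rewrite /f; case: ifP; lia.
  have -> : i = k.-1 by lia.
  rewrite (level_last k0 fk) lsum_last card_initial //; split=> //.
    apply/indepP => s st; rewrite -[X in _ <= X](@card_initial N).
      by apply/subset_leq_card/subsetP => x; rewrite !inE => /andP[].
    by apply: leq_trans tN; rewrite leq_mul2r st orbT.
  by apply/subsetP => x /ltC; rewrite inE; apply; lia.
have [|f [fk mf fi]] := IH m.+1; first by lia.
have [|c1 i1 s1] := fi m.+1 (leqnn _); first by lia.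
have [|x|I [sCI sI iI cI]] :=
    indep_extend (leq_lsum (leqnSn m)) (subset_trans (CS m) s1) _ i1 c1.
- by apply: iC; lia.
- by rewrite inE -fk; lia.
have {}sI x : x \in I -> f x = m.+1.
  by move=> /(subsetP sI); rewrite inE; have := mf x; lia.
(* As [f] has no value below [m.+1], lowering [I] to [m] creates level [m] and keeps the higher
   levels. *)
exists (fun x => if x \in I then m else f x); split=> [x|x|i mi ik].
- by rewrite -fk; have := sI x; case: ifP => // _ /(_ isT); lia.
- by have := mf x; case: ifP => //; lia.
have [im|im] := eqVneq i m.
  have -> : level (fun x => if x \in I then m else f x) i = I.
    by apply/setP => x; rewrite inE; have := mf x; case: ifP; lia.
  by rewrite im.
have -> : level (fun x => if x \in I then m else f x) i = level f i.
  by apply/setP => x; rewrite !inE; have := sI x; case: ifP => // _ /(_ isT); lia.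
by apply: fi; lia.
Qed.

Lemma card_new_balls t : t.+1 * L <= N -> #|new_balls l N t| = L.
Proof.
move=> tN; have := card_initial tN; rewrite (below_above [set x : 'I_N | x < t.+1 * L] (t * L)).
have -> : below [set x : 'I_N | x < t.+1 * L] (t * L) = [set x : 'I_N | x < t * L].
  by apply/setP => x; rewrite !inE mulSn; lia.
rewrite card_initial; last by move: tN; rewrite mulSn; lia.
have -> : above [set x : 'I_N | x < t.+1 * L] (t * L) = new_balls l N t.
  by apply/setP => x; rewrite !inE andbC.
by rewrite mulSn; lia.
Qed.

Lemma card_level_put t f i : t.+1 * L <= N -> i < k ->
    (forall x, (f x < k) = (x < t * L)) ->
  #|level (fun x => if x \in new_balls l N t then 0 else f x) i| =
  #|level f i| + L.
Proof.
move=> tN ik fk; rewrite -(card_new_balls tN) -[LHS](cardsID (new_balls l N t)) addnC.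
congr (_ + _); apply: eq_card => x; rewrite !inE; have := fk x;
  by case: (boolP (_ <= _ < _)) => xt; lia.
Qed.

Lemma after_turnsP t G : 0 < k -> t * L <= N ->
  (G \in after_turns l N t) <-> (exists2 f, valid t f & G = bins_of f).
Proof.
move=> k0; elim: t G => [|t IH] G tN /=.
  rewrite inE; split => [/eqP ->|[f [fk _] ->]].
    exists (fun=> k).
      have lev0 i : i < k -> level (fun=> k) i = set0.
        by move=> ik; apply/setP => x; rewrite !inE; lia.
      split=> [x|i ik]; first by lia.
      by rewrite lev0 // cards0; split=> //; apply: indep0.
    apply/ffunP => j; rewrite !ffunE; apply/setP => x; rewrite !inE.
    by have := ltn_ord j; lia.
  apply/eqP/ffunP => j; rewrite !ffunE; apply/setP => x; rewrite !inE.
  by have := fk x; have := ltn_ord j; lia.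
have tN' : t * L <= N by move: tN; rewrite mulSn; lia.
split=> [/bigcupP[G1 /(IH _ tN')[f [fk fi] ->]]|[g [gk gi] ->]].
  move=> /(turnP _ fk)[g [fg cg] ->]; exists g => //.
  have gk x : (g x < k) = (x < t.+1 * L).
    have := fg x; have := fk x; rewrite inE mulSn.
    by case: (boolP (_ <= _ < _)); lia.
  split=> // i ik.
  have cgi : #|level g i| = t.+1 * lsum i.
    have [ik1|ik1] := ltnP i k.-1; last first.
      have -> : i = k.-1 by lia.
      by rewrite (level_last k0 gk) card_initial // lsum_last.
    have := cg i ik1; rewrite card_level_put // (fi i ik).1 -(lsum_tail i) mulSn.
    lia.
  split=> //; apply/indepP => s; rewrite leq_eqVlt => /orP[/eqP ->|st].
    by rewrite -cgi; apply/subset_leq_card/subsetP => x; rewrite inE => /andP[].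
  (* Balls only advance, so among the first [s * L] balls, all of them old, level [i] can only have
     shrunk. *)
  have /indepP/(_ s st) := (fi i ik).2; apply: leq_trans.
  have sL : s * L <= t * L by rewrite leq_mul2r -ltnS st orbT.
  apply/subset_leq_card/subsetP => x; rewrite !inE; have := fg x.
  by rewrite inE; case: (boolP (_ <= _ < _)); lia.
have [|i ik|i x _|f [fk fi] Cf] :=
    @valid_extend t (fun i => below (level g i) (t * L)) k0 tN'.
- by move=> i; apply/belowS/subsetP => x; rewrite !inE; lia.
- apply/indepP => s st; have [_ /indepP/(_ s)] := gi i ik.
  have -> : below (below (level g i) (t * L)) (s * L) = below (level g i) (s * L).
    have : s * L <= t * L by rewrite leq_mul2r st orbT.
    by move=> sL; apply/setP => x; rewrite !inE; lia.
  by apply; apply: leqW.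
- by rewrite inE => /andP[].
apply/bigcupP; exists (bins_of f); first by apply/(IH _ tN'); exists f.
apply/(turnP _ fk).
(* All numbers from [k] on encode a ball not in play, but [moved] compares them; taking them from
   [f] changes no bin and meets its bounds. *)
pose g' x := if x < t.+1 * L then g x else f x.
have tL : t * L <= t.+1 * L by rewrite leq_mul2r leqnSn orbT.
have lev i : i < k -> level g' i = level g i.
  move=> ik; apply/setP => x; rewrite !inE /g'.
  by have := gk x; have := fk x; case: ifP; lia.
exists g'; last first.
  apply/ffunP => j; rewrite !ffunE; apply/setP => x; rewrite !inE /g'.
  by have := gk x; have := fk x; have := ltn_ord j; case: ifP; lia.
split=> [x|i ik].
  (* An old ball lies in the restricted level [g x] of [g], which [Cf] places inside level [g x] of
     [f]. *)
  have fg : x < t * L -> f x <= g x.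
    move=> xt; have gxk : g x < k by rewrite gk; lia.
    by have /subsetP/(_ x) := Cf _ gxk; rewrite !inE leqnn xt => /(_ isT).
  have := gk x; have := fk x; rewrite inE /g'; move: fg.
  have [xt /(_ isT)|tx _] := ltnP x (t * L); first by rewrite (leq_trans xt tL) /=; lia.
  by have [xt|tx'] := ltnP x (t.+1 * L) => /=; lia.
have ik' : i < k by lia.
rewrite lev // card_level_put // (gi i ik').1 (fi i ik').1.
by rewrite mulSn -[in RHS](lsum_tail i); lia.
Qed.

End Positions.

(** * Flag matroid axioms for the configurations *)

Lemma configurationsP n G : 0 < k ->
  (G \in configurations l n) <-> (exists2 f, valid n f & G = bins_of f).
Proof. by move=> k0; apply: after_turnsP. Qed.

Lemma bases_spec_tbp n (i : 'I_k) :
  bases_spec (tbp_matroid n (\sum_(j < k | j <= i) l j) (\sum_(j < k | i < j) l j)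
                (split_balls l n i)) (lsum i).
Proof. by move=> B; rewrite tbp_bases -/(lsum i) lsum_tail. Qed.

Lemma configuration_prefix n (i : 'I_k) (B : {set 'I_(n * L)}) :
  (#|B| == n * lsum i) && indep L n (lsum i) B =
  (B \in [set prefix_union i A | A in configurations l n]).
Proof.
have k0 : 0 < k by apply: leq_ltn_trans (ltn_ord i).
apply/andP/imsetP => [[/eqP cB iB]|[A /(configurationsP _ k0)[f [_ fi] ->] ->]].
  (* The chain is [B] from index [i] on and empty before; [B] stays independent as [lsum] grows.
     Level [i] of the result contains [B] and has the same size. *)
  have [j|j jk|j x _ _|f vf Cf] :=
      @valid_extend _ n (fun j => if i <= j then B else set0) k0 (leqnn _).
  - case: ifP => [ij|_]; last exact: sub0set.
    by rewrite (leq_trans ij (leqnSn j)).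
  - by case: ifP => [/leq_lsum/indep_leq|_]; [apply|apply: indep0].
  - exact: ltn_ord.
  exists (bins_of f); first by apply/configurationsP => //; exists f.
  rewrite prefix_union_bins_of; apply/eqP; rewrite eqEcard (vf.2 i _).1 // cB leqnn andbT.
  by have := Cf i (ltn_ord i); rewrite leqnn.
by rewrite prefix_union_bins_of; have [-> ->] := fi i (ltn_ord i).
Qed.

(** Bin [i] is the difference of consecutive levels, whose sizes differ by [n * l i], and the first
    bin is level [0], so none is empty. *)
Lemma configuration_partition n A : 0 < n -> (forall j, 0 < l j) -> 0 < k ->
  A \in configurations l n -> ordered_partition A.
Proof.
move=> n0 l0 k0 /(configurationsP _ k0)[f [fk fi] ->]; apply/and3P; split.
- apply/forallP => i; apply/negP => /eqP Ai0.
  have fxi x : f x != i.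
    by move/setP: Ai0 => /(_ x); rewrite ffunE !inE => ->.
  have [ci _] := fi i (ltn_ord i).
  have [i0|i0] := posnP i.
    have li : 0 < lsum i by rewrite /lsum (bigD1 i) //= ltn_addr.
    have : 0 < #|level f i| by rewrite ci muln_gt0 n0.
    by case/card_gt0P => x; rewrite inE; have := fxi x; lia.
  have i1k : i.-1 < k by have := ltn_ord i; lia.
  have [ci1 _] := fi _ i1k.
  have : #|level f i| = #|level f i.-1|.
    by apply: eq_card => x; rewrite !inE; have := fxi x; lia.
  rewrite ci ci1 (@lsumS i i.-1) ?prednK // mulnDr => /eqP.
  have : 0 < n * l i by rewrite muln_gt0 n0 l0.
  lia.
- apply/forallP => i; apply/forallP => j; apply/implyP => ij.
  rewrite -setI_eq0; apply/eqP/setP => x; rewrite !ffunE !inE.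
  by apply: contraNF ij => /andP[/eqP -> /eqP/val_inj ->].
apply/eqP/setP => x; rewrite inE; apply/bigcupP.
have fxk : f x < k by rewrite fk.
by exists (Ordinal fxk); rewrite // ffunE inE.
Qed.

(** Number each ball by its block in [A]. The levels are then the prefix unions of [A], which are
    bases by [configuration_prefix], so the numbering is valid. *)
Lemma configuration_saturated n A : 0 < k -> ordered_partition A ->
    (forall i, prefix_union i A \in [set prefix_union i B | B in configurations l n]) ->
  A \in configurations l n.
Proof.
move=> k0 /and3P[_ /forallP dA /eqP cA] pA.
have Ax x : exists j : 'I_k, x \in A j.
  have : x \in \bigcup_i A i by rewrite cA inE.
  by case/bigcupP => j _ xj; exists j.
pose f x : nat := xchoose (Ax x).
have eA : A = bins_of f.
  apply/ffunP => j; rewrite ffunE; apply/setP => x; rewrite inE /f.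
  have := xchooseP (Ax x); set j' := xchoose _ => xj'.
  apply/idP/eqP => [xj|/val_inj <- //].
  apply/eqP; apply: contraT => jj'.
  have /forallP/(_ j)/implyP/(_ jj') := dA j'.
  by rewrite -setI_eq0 => /eqP/setP/(_ x); rewrite !inE xj xj'.
apply/configurationsP => //; exists f => //; split=> [x|i ik].
  by rewrite /f !ltn_ord.
have := pA (Ordinal ik); rewrite -configuration_prefix eA prefix_union_bins_of.
by case/andP => /eqP.
Qed.

End TennisBall.

Theorem theorem2p4 (k n : nat) (hk : 1 <= k) (hn : 1 <= n)
    (l : 'I_k -> nat) (hl : forall j : 'I_k, 0 < l j) :
  exists FM : flag_matroid k 'I_(n * balls_per_turn l),
    flag_bases FM = configurations l n /\
    (forall i : 'I_k,
       constituent FM i =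
       tbp_matroid n (\sum_(j < k | j <= i) l j) (\sum_(j < k | i < j) l j)
         (split_balls l n i)).
Proof.
pose M (i : 'I_k) := tbp_matroid n (\sum_(j < k | j <= i) l j)
  (\sum_(j < k | i < j) l j) (split_balls l n i).
have basesM i : bases (M i) = [set prefix_union i A | A in configurations l n].
  by apply/setP => B; rewrite bases_spec_tbp configuration_prefix.
have quotM (i j : 'I_k) : j = i.+1 :> nat -> quotient_of (M i) (M j).
  move=> ij; have leij : lsum l i <= lsum l j by rewrite leq_lsum // ij.
  exact: (nested_quotient leij (lsum_leq l j) (@bases_spec_tbp _ l n i) (@bases_spec_tbp _ l n j)).
have satM A : ordered_partition A ->
    (forall i, prefix_union i A \in bases (M i)) -> A \in configurations l n.
  by move=> oA pA; apply: configuration_saturated => // i; rewrite -basesM.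
by exists (FlagMatroid (fun A => configuration_partition hn hl hk) basesM quotM satM).
Qed.
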